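(* Let $m,n\ge1$ be integers, let $\nu=(\nu_1,\ldots,\nu_n)$ be a probability vector with positive entries, and for each $i\in[n]$ let $r_i\colon\{1,2,\ldots\}\to(0,\infty)$, with the convention $r_i(0)=0$, satisfy $r_i(k)\ge r_i(k-1)$ for all $k\in[m]$. Consider the mean-field Zero-Range Process with $m$ particles on $n$ sites, i.e. the continuous-time Markov chain on $$\mathcal{X}:=\left\{(x_1,\ldots,x_n)\in\mathbb{Z}_+^n\colon\sum_{i=1}^nx_i=m\right\}$$ with generator $$(Lf)(x):=\sum_{1\le i,j\le n}r_i(x_i)\,\nu_j\left(f(x+\delta_j-\delta_i)-f(x)\right),$$ and let $\pi$ be its unique invariant law and $P_t:=e^{tL}$. Then $$\forall\mu\in\mathcal{P}(\mathcal{X}),\quad\forall t\ge0,\qquad H(\mu P_t\,|\,\pi)\le e^{-\delta t}H(\mu\,|\,\pi),\qquad\text{where}\quad\delta:=\min_{i\in[n],\,k\in[m]}\{r_i(k)-r_i(k-1)\}.$$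
   Context: $[n]=\{1,\ldots,n\}$, $[m]=\{1,\ldots,m\}$; $(\delta_1,\ldots,\delta_n)$ is the canonical basis of $\mathbb{R}^n$ (terms with $x_i=0$ vanish since $r_i(0)=0$). The invariant law is explicitly $\pi(x)=\frac1C\prod_{i=1}^n\frac{\nu_i^{x_i}}{r_i(1)r_i(2)\cdots r_i(x_i)}$ with $C$ a normalizing constant. $\mathcal{P}(\mathcal{X})$ is the set of probability measures on $\mathcal{X}$, and $H(\mu\,|\,\pi):=\sum_x\mu(x)\log(\mu(x)/\pi(x))$ is the relative entropy (with $0\log0=0$). *)

(* Defs.v *)
(* MathComp / MathComp-Analysis, over an arbitrary [R : realType]. *)
From HB Require Import structures.
From mathcomp Require Import all_boot all_order all_algebra.
From mathcomp Require Import all_classical all_reals all_analysis.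

Set Implicit Arguments.
Unset Strict Implicit.
Unset Printing Implicit Defensive.

Import Order.TTheory GRing.Theory Num.Theory.
Import numFieldNormedType.Exports.

Local Open Scope ring_scope.

(* Sites are numbered from 0, so [n] is rendered as 'I_n.  Occupation numbers
   take values in 'I_m.+1, which costs nothing as they sum to m and makes the
   state space a finType. *)
Notation zrp_state m n :=
  {x : {ffun 'I_n -> 'I_m.+1} | (\sum_(i < n) x i == m)%N}.

Definition occ (m n : nat) (x : zrp_state m n) (i : 'I_n) : nat := val x i.

(* x + delta_j - delta_i when x_i > 0 (see [occ_jump]).  When x_i = 0 the value
   is irrelevant: the jump is always weighted by the rate r_i(0) = 0. *)
Definition jump (m n : nat) (x : zrp_state m n) (i j : 'I_n) : zrp_state m n :=
  insubd x [ffun k => inord (occ x k + (k == j) - (k == i))%N].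

Lemma occ_jump (m n : nat) (x : zrp_state m n) (i j k : 'I_n) :
  (0 < occ x i)%N -> (occ (jump x i j) k + (k == i) = occ x k + (k == j))%N.
Proof.
move=> xi0; set y := fun k : 'I_n => (occ x k + (k == j) - (k == i))%N.
have yE l : (y l + (l == i) = occ x l + (l == j))%N.
  rewrite /y subnK //; case: (eqVneq l i) => [->|//].
  exact: leq_trans xi0 (leq_addr _ _).
have sum1 (l : 'I_n) : (\sum_(k < n) (k == l))%N = 1%N.
  rewrite (bigD1 l) //= eqxx big1 ?addn0 // => p pl.
  by rewrite (negbTE pl).
have sumy : (\sum_(k < n) y k)%N = m.
  apply/eqP; rewrite -(eqn_add2r (\sum_(k < n) (k == i))) -big_split /=.
  under eq_bigr do rewrite yE.
  rewrite big_split /= !sum1 eqn_add2r; exact: (valP x).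
have yK l : (inord (y l) : 'I_m.+1) = y l :> nat.
  by rewrite inordK // ltnS -[leqRHS]sumy (bigD1 l) //= leq_addr.
rewrite /jump {1}/occ val_insubd.
have -> : (\sum_(l < n) [ffun k => inord (y k) : 'I_m.+1] l == m)%N.
  by under eq_bigr do rewrite ffunE yK; rewrite sumy.
by rewrite ffunE yK.
Qed.

Section ZeroRange.
Context {R : realType} {m n : nat}.
Implicit Types (r : 'I_n -> nat -> R) (nu : 'I_n -> R).
Implicit Types (f mu pi : zrp_state m n -> R).

Definition zrp_gen r nu f : zrp_state m n -> R := fun x =>
  \sum_(i < n) \sum_(j < n) r i (occ x i) * nu j * (f (jump x i j) - f x).

(* The series of the exponential e^{tL} applied to f, evaluated at x. *)
Definition zrp_semigroup r nu (t : R) f : zrp_state m n -> R := fun x =>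
  limn (series (fun k => t ^+ k / k`!%:R * iter k (zrp_gen r nu) f x)).

(* mu P_t, as a measure: (mu P_t)(y) = sum_x mu(x) (P_t 1_{y})(x). *)
Definition zrp_evolve r nu (t : R) mu : zrp_state m n -> R := fun y =>
  \sum_(x : zrp_state m n)
     mu x * zrp_semigroup r nu t (fun z => (z == y)%:R) x.

(* mathcomp-analysis sets ln 0 = 0 and x / 0 = 0.  Only reference laws pi with
   full support are relevant, so the latter convention plays no role. *)
Definition rel_entropy mu pi : R :=
  \sum_(x : zrp_state m n) mu x * ln (mu x / pi x).

Definition zrp_increments (m' : nat) r : seq R :=
  [seq r i k - r i k.-1 | i <- enum 'I_n, k <- iota 1 m'].

(* The minimum of a list that is non-empty as soon as m', n >= 1; the initial
   value of the iterated minimum is the head of the list. *)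
Definition zrp_delta (m' : nat) r : R :=
  let s := zrp_increments m' r in \big[Num.min/head 0 s]_(d <- s) d.

End ZeroRange.

Definition is_law {R : realType} {T : finType} (p : T -> R) : Prop :=
  (forall x, 0 <= p x) /\ \sum_(x : T) p x = 1.

Definition zrp_invariant {R : realType} {m n : nat} (r : 'I_n -> nat -> R)
    (nu : 'I_n -> R) (pi : zrp_state m n -> R) : Prop :=
  is_law pi /\ forall t, 0 <= t -> zrp_evolve r nu t pi = pi.

(* Main.v *)
(* Let [P = e^{tL}].  Call two configurations adjacent if they differ by the
   position of one particle, and couple them by moving all other particles
   together: the two distinguished particles merge at rate at least [delta], and
   adjacency is preserved.  Hence [P] contracts Lipschitz constants by
   [e^{-delta t}], and does not increase the Lipschitz constant of [ln f] for
   positive [f].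

   These two facts imply the entropy contraction, following the idea of Caputo,
   Muench and Salez.  For [c > e^{-delta t}] put [G f = Ent (P f) - c Ent f], and
   let [g] be the probability density proportional to [exp (P (ln (P f)) / c)].
   By reversibility and two applications of the Gibbs variational principle,
   [G f <= G g], while the Lipschitz constant of [ln g] is at most
   [e^{-delta t} / c] times that of [ln f].  Iterating [f |-> g] drives [f] to the
   constant density, where [G] vanishes; so [G f <= 0]. *)

Require Import Defs.
From HB Require Import structures.
From mathcomp Require Import all_boot all_order all_algebra.
From mathcomp Require Import all_classical all_reals all_analysis.
From mathcomp Require Import ring lra zify.
Set Implicit Arguments.
Unset Strict Implicit.
Unset Printing Implicit Defensive.
Import Order.TTheory GRing.Theory Num.Theory.
Import numFieldNormedType.Exports.
Local Open Scope ring_scope.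

(** * Entropy contraction for reversible kernels *)

Section Entropy.
Context {R : realType} {T : finType}.
Implicit Types (p f g u : T -> R) (K : T -> T -> R).

Definition mean p f : R := \sum_x p x * f x.

Lemma le_mean p f g : (forall x, 0 <= p x) -> (forall x, f x <= g x) ->
  mean p f <= mean p g.
Proof. by move=> p0 fg; apply: ler_sum => x _; rewrite ler_wpM2l. Qed.

Lemma eq_mean p f g : f =1 g -> mean p f = mean p g.
Proof. by move=> fg; apply: eq_bigr => x _; rewrite fg. Qed.

Lemma meanD p f g : mean p (fun x => f x + g x) = mean p f + mean p g.
Proof.
by rewrite /mean -big_split /=; apply: eq_bigr => x _; rewrite mulrDr.
Qed.

Lemma meanZ p f a : mean p (fun x => a * f x) = a * mean p f.
Proof. by rewrite /mean mulr_sumr; apply: eq_bigr => x _; rewrite mulrCA. Qed.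

Lemma meanB p f g : mean p (fun x => f x - g x) = mean p f - mean p g.
Proof.
rewrite -mulN1r -meanZ -meanD.
by apply: eq_mean => x; rewrite mulN1r.
Qed.

Lemma mean_cst p a : is_law p -> mean p (fun=> a) = a.
Proof. by case=> _ p1; rewrite /mean -mulr_suml p1 mul1r. Qed.

Lemma mean_gt0 p f : is_law p -> (forall x, 0 < f x) -> 0 < mean p f.
Proof.
move=> [p0 p1] f0.
have m0 : 0 <= mean p f by apply: sumr_ge0 => x _; rewrite mulr_ge0// ltW.
rewrite lt_neqAle m0 andbT eq_sym; apply/eqP => /psumr_eq0P.
move=> /(_ (fun x _ => mulr_ge0 (p0 x) (ltW (f0 x)))) pf0.
suff : \sum_x p x = 0 by rewrite p1 => /eqP; rewrite oner_eq0.
apply: big1 => x _; apply/eqP; have /eqP := pf0 x isT.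
by rewrite mulf_eq0 (gt_eqF (f0 x)) orbF.
Qed.

Definition entropy p f : R := mean p (fun x => f x * ln (f x)).

Lemma ln_le_subr1 (x : R) : 0 < x -> ln x <= x - 1.
Proof.
by move=> x0; have := @le_ln1Dx R (x - 1); rewrite addrCA subrr addr0; apply; lra.
Qed.

(** Multiply [ln z <= z - 1] by [f x], with [z = expR (u x) / (f x * Z)] the ratio of the density
    proportional to [expR u] to [f], and average. Points where [f] vanishes are treated apart. *)
Lemma gibbs_variational p f u : is_law p -> (forall x, 0 <= f x) ->
  mean p f = 1 ->
  mean p (fun x => f x * u x) <= entropy p f + ln (mean p (fun x => expR (u x))).
Proof.
move=> lp f0 f1; set Z := mean p (fun x => expR (u x)).
have Z0 : 0 < Z by apply: mean_gt0 => // x; exact: expR_gt0.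
have H x : f x * u x - f x * ln (f x) - f x * ln Z <= expR (u x) / Z - f x.
  have := f0 x; rewrite le_eqVlt => /predU1P[<-|fx].
    by rewrite !mul0r !subr0 divr_ge0 ?expR_ge0// ltW.
  have -> : f x * u x - f x * ln (f x) - f x * ln Z =
            f x * ln (expR (u x) / (f x * Z)).
    rewrite ln_div ?posrE ?expR_gt0 ?mulr_gt0// expRK lnM ?posrE//; ring.
  apply: le_trans (ler_wpM2l (f0 x) (ln_le_subr1 _)) _.
    by rewrite divr_gt0 ?expR_gt0 ?mulr_gt0.
  suff -> : f x * (expR (u x) / (f x * Z) - 1) = expR (u x) / Z - f x by [].
  by field; rewrite !gt_eqF.
have := le_mean (proj1 lp) H; rewrite !meanB f1.
under [X in _ <= X - _]eq_mean do rewrite mulrC.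
rewrite meanZ -/Z mulVf ?gt_eqF// subrr.
have -> : mean p (fun x => f x * ln Z) = ln Z.
  by under eq_mean do rewrite mulrC; rewrite meanZ f1 mulr1.
by rewrite /entropy; lra.
Qed.

Lemma entropy_ge0 p f : is_law p -> (forall x, 0 <= f x) -> mean p f = 1 ->
  0 <= entropy p f.
Proof.
move=> lp f0 f1; have := @gibbs_variational p f (fun=> 0) lp f0 f1.
rewrite mean_cst// expR0 ln1 addr0; apply: le_trans.
by rewrite /mean big1// => x _; rewrite !mulr0.
Qed.

End Entropy.

Section EntropyContraction.
Local Open Scope classical_set_scope.
Local Open Scope ring_scope.
Context {R : realType} {T : finType}.
Context (p : T -> R) (K : T -> T -> R) (e : rel T) (D : nat) (rho : R).
Implicit Types (f g u : T -> R) (c l : R).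

Let P f : T -> R := fun x => mean (K x) f.

(** A Lipschitz bound checked on the edges of [e] only; [osc] below makes it global, [D] acting as
    the diameter of the graph. *)
Definition lip f l : Prop := forall x y, e x y -> f x <= f y + l.

Context (lp : is_law p) (lK : forall x, is_law (K x)).
Context (K_gt0 : forall x y, 0 < K x y).
Context (K_rev : forall x y, p x * K x y = p y * K y x).
Context (osc : forall f l, lip f l -> forall x y, f x <= f y + D%:R * l).
Context (rho_ge0 : 0 <= rho).
Context (K_lip : forall f l, 0 <= l -> lip f l -> lip (P f) (rho * l)).
Context (K_loglip : forall f c, (forall x, 0 <= f x) -> 1 <= c ->
  (forall x y, e x y -> f x <= c * f y) ->
  forall x y, e x y -> P f x <= c * P f y).

Lemma mean_act f g : mean p (fun x => P f x * g x) = mean p (fun x => f x * P g x).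
Proof.
rewrite /mean /P /mean.
under eq_bigr do rewrite mulr_suml mulr_sumr.
under [RHS]eq_bigr do rewrite !mulr_sumr.
rewrite exchange_big; apply: eq_bigr => x _; apply: eq_bigr => y _ /=.
rewrite !mulrA K_rev; ring.
Qed.

Lemma mean_act1 f : mean p (P f) = mean p f.
Proof.
have := mean_act f (fun=> 1).
under eq_mean do rewrite mulr1.
by under [RHS]eq_mean do rewrite /P mean_cst// mulr1.
Qed.

(** Positivity of the kernel makes [ln (P f)] meaningful even if [f] vanishes somewhere. *)
Lemma act_gt0 f x : (forall x, 0 <= f x) -> mean p f = 1 -> 0 < P f x.
Proof.
move=> f0 f1.
have P0 : 0 <= P f x by apply: sumr_ge0 => y _; rewrite mulr_ge0// ltW.
rewrite lt_neqAle P0 andbT eq_sym; apply/eqP => /psumr_eq0P.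
move=> /(_ (fun y _ => mulr_ge0 (ltW (K_gt0 x y)) (f0 y))) Kf0.
suff : mean p f = 0 by rewrite f1 => /eqP; rewrite oner_eq0.
apply: big1 => y _; have /eqP := Kf0 y isT.
by rewrite mulf_eq0 (gt_eqF (K_gt0 x y))/= => /eqP ->; rewrite mulr0.
Qed.

(** A Lipschitz bound [l] on [ln f] is a ratio bound [expR l] on [f], which [K_loglip]
    propagates. *)
Lemma lip_ln_act f l : (forall x, 0 < f x) -> 0 <= l ->
  lip (fun x => ln (f x)) l -> lip (fun x => ln (P f x)) l.
Proof.
move=> f0 l0 fl x y exy.
have Pf0 z : 0 < P f z by exact: mean_gt0.
rewrite -ler_expR expRD !lnK ?posrE// mulrC.
apply: K_loglip exy => [z|| z w /fl]; first exact: ltW.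
  by rewrite -expR0 ler_expR.
by rewrite -ler_expR expRD !lnK ?posrE// mulrC.
Qed.

(** The entropy of [P f] is an average of [ln (P f)], hence exceeds any value [ln (P f y)] by at
    most [D * l]; averaging over [y] leaves a nonpositive term by Jensen. *)
Lemma entropy_act_le_lip f l : (forall x, 0 < f x) -> mean p f = 1 -> 0 <= l ->
  lip (fun x => ln (f x)) l -> entropy p (P f) <= D%:R * l.
Proof.
move=> f0 f1 l0 fl.
have Pf0 x : 0 < P f x by exact: mean_gt0.
have Pf1 : mean p (P f) = 1 by rewrite mean_act1.
have Dl := osc (lip_ln_act f0 l0 fl).
have H y : entropy p (P f) <= ln (P f y) + D%:R * l.
  rewrite -[leRHS]mulr1 -[X in _ * X]Pf1 -meanZ; apply: le_mean => [x|x].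
    exact: (proj1 lp).
  by rewrite mulrC ler_wpM2r ?Dl// ltW.
have := le_mean (proj1 lp) H; rewrite mean_cst// meanD (mean_cst _ lp).
(* Jensen's inequality for [ln], read off from the Gibbs principle with constant density. *)
have := @gibbs_variational _ _ p (fun=> 1) (fun x => ln (P f x)) lp
  (fun=> ler01) (mean_cst 1 lp).
under eq_mean do rewrite mul1r.
under [X in ln X]eq_mean do rewrite lnK ?posrE//.
rewrite Pf1 ln1 addr0 /entropy ln1 mulr0 mean_cst//; lra.
Qed.

Let gap c f : R := entropy p (P f) - c * entropy p f.

Let step c f : T -> R := fun x =>
  expR (c^-1 * P (fun y => ln (P f y)) x) /
  mean p (fun z => expR (c^-1 * P (fun y => ln (P f y)) z)).

Lemma step_norm_gt0 c f :
  0 < mean p (fun z => expR (c^-1 * P (fun y => ln (P f y)) z)).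
Proof. by apply: mean_gt0 => // z; exact: expR_gt0. Qed.

Lemma step_gt0 c f x : 0 < step c f x.
Proof. by rewrite divr_gt0 ?expR_gt0 ?step_norm_gt0. Qed.

Lemma mean_step c f : mean p (step c f) = 1.
Proof.
rewrite /step; under eq_mean do rewrite mulrC.
by rewrite meanZ mulVf// gt_eqF// step_norm_gt0.
Qed.

(* [step c f] maximises [mean p (g * P (ln (P f))) - c * entropy p g], a lower
   bound for [gap c g] which is attained at [g = f]. *)
Lemma gap_le_step c f : 0 < c -> (forall x, 0 <= f x) -> mean p f = 1 ->
  gap c f <= gap c (step c f).
Proof.
move=> c0 f0 f1; set h := P (fun y => ln (P f y)).
have Pf0 x : 0 < P f x by exact: act_gt0.
set Z := mean p (fun z => expR (c^-1 * h z)).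
have Z0 : 0 < Z by exact: step_norm_gt0.
have Ef : entropy p (P f) = c * mean p (fun x => f x * (c^-1 * h x)).
  rewrite -meanZ /entropy mean_act; apply: eq_mean => x.
  by rewrite mulrCA [c * _]mulrA mulfV ?gt_eqF// mul1r.
have Eg : entropy p (step c f) = mean p (fun x => step c f x * (c^-1 * h x)) - ln Z.
  rewrite /entropy -[X in _ - X]mulr1 -(mean_step c f) -meanZ -meanB.
  apply: eq_mean => x; rewrite {2}/step ln_div ?posrE ?expR_gt0// expRK.
  by rewrite -/h -/Z; ring.
have g0 x : 0 <= step c f x by exact/ltW/step_gt0.
(* Gibbs principle for the density [P (step c f)] against [ln (P f)], whose exponential [P f] has
   mean 1. *)
have EPg : c * mean p (fun x => step c f x * (c^-1 * h x)) <= entropy p (P (step c f)).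
  rewrite -meanZ; under eq_mean do
    rewrite mulrCA [c * _]mulrA mulfV ?gt_eqF// mul1r.
  rewrite -mean_act.
  apply: le_trans (gibbs_variational _ lp _ _) _; last 1 first.
  - under [X in ln X]eq_mean do rewrite lnK ?posrE//.
    by rewrite mean_act1 f1 ln1 addr0.
  - by move=> x; apply/ltW/act_gt0 => //; exact: mean_step.
  - by rewrite mean_act1 mean_step.
(* With [Ef] this gives [gap c f <= c * ln Z], while [Eg] and [EPg] give
   [c * ln Z <= gap c (step c f)]. *)
have := gibbs_variational (fun x => c^-1 * h x) lp f0 f1.
rewrite -(ler_pM2l c0) -/Z mulrDr -Ef => Hf.
rewrite /gap Eg mulrBr; lra.
Qed.

(** The normalising constant cancels in differences; [K_lip] supplies the factor [rho], the exponent
    the factor [c^-1]. *)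
Lemma lip_ln_step c f l : 0 < c -> (forall x, 0 < f x) -> mean p f = 1 ->
  0 <= l -> lip (fun x => ln (f x)) l ->
  lip (fun x => ln (step c f x)) (rho / c * l).
Proof.
move=> c0 f0 f1 l0 fl x y exy.
rewrite /step !ln_div ?posrE ?expR_gt0 ?step_norm_gt0// !expRK.
have := K_lip l0 (lip_ln_act f0 l0 fl) exy.
rewrite -(@ler_pM2l _ c^-1) ?invr_gt0// mulrDr.
have -> : c^-1 * (rho * l) = rho / c * l by ring.
by lra.
Qed.

(** Each [step] does not lower the gap and multiplies the Lipschitz constant by [rho / c], so the
    induction generalises over [f] and [l]. In the base case the nonpositive term
    [- c * entropy p f] is dropped. *)
Lemma gap_le_geometric c k f l : 0 < c -> (forall x, 0 < f x) ->
  mean p f = 1 -> 0 <= l -> lip (fun x => ln (f x)) l ->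
  gap c f <= D%:R * l * (rho / c) ^+ k.
Proof.
move=> c0; elim: k f l => [|k IH] f l f0 f1 l0 fl.
  rewrite mulr1; apply: le_trans (entropy_act_le_lip f0 f1 l0 fl).
  rewrite /gap gerBl mulr_ge0 ?entropy_ge0// => [|x]; exact: ltW.
have rc : 0 <= rho / c by rewrite divr_ge0// ltW.
apply: le_trans (gap_le_step c0 (fun x => ltW (f0 x)) f1) _.
rewrite exprS mulrA -[_ * (rho / c)]mulrA [l * _]mulrC.
apply: IH; [exact: step_gt0|exact: mean_step|exact: mulr_ge0|].
exact: lip_ln_step.
Qed.

Lemma lip_exists f : exists2 l, 0 <= l & lip f l.
Proof.
exists (\sum_x \sum_y `|f x - f y|).
  by apply: sumr_ge0 => x _; exact: sumr_ge0.
move=> x y _; rewrite -lerBlDl; apply: le_trans (ler_norm _) _.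
rewrite (bigD1 x)//= (bigD1 y)//= -addrA ler_wpDr// addr_ge0//.
  exact: sumr_ge0.
by apply: sumr_ge0 => z _; exact: sumr_ge0.
Qed.

Lemma gap_le0 c f : rho < c -> (forall x, 0 <= f x) -> mean p f = 1 ->
  gap c f <= 0.
Proof.
move=> rc f0 f1; have c0 : 0 < c by exact: le_lt_trans rc.
(* A first step replaces [f], which may vanish, by a positive density, to which the geometric bound
   applies. *)
apply: le_trans (gap_le_step c0 f0 f1) _.
have [l l0 fl] := lip_exists (fun x => ln (step c f x)).
have q0 : 0 <= rho / c by rewrite divr_ge0// ltW.
have q1 : `|rho / c| < 1 by rewrite ger0_norm// ltr_pdivrMr// mul1r.
have cv : (fun k => D%:R * l * (rho / c) ^+ k) @ \oo --> (0 : R).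
  by rewrite -[X in _ --> X](mulr0 (D%:R * l)); apply: cvgMl_tmp; exact: cvg_expr.
apply: (cvgr_to_ge cv).
by near=> k; apply: gap_le_geometric => //; [exact: step_gt0|exact: mean_step].
Unshelve. all: by end_near. Qed.

Lemma entropy_contraction f : (forall x, 0 <= f x) -> mean p f = 1 ->
  entropy p (P f) <= rho * entropy p f.
Proof.
move=> f0 f1; have E0 := entropy_ge0 lp f0 f1.
apply/ler_addgt0Pr => eps eps0.
(* [gap_le0] requires [c > rho]; this excess over [rho] costs less than [eps], and the [+ 1] avoids
   dividing by a zero entropy. *)
have d0 : 0 < eps / (entropy p f + 1) by rewrite divr_gt0// ltr_wpDl.
have := @gap_le0 (rho + eps / (entropy p f + 1)) f; rewrite ltrDl /gap subr_le0.
move=> /(_ d0 f0 f1)/le_trans; apply; rewrite mulrDl lerD2l.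
by rewrite mulrAC ler_pdivrMr ?ltr_wpDl// ler_pM2l// lerDl.
Qed.

End EntropyContraction.

(** * Euler scheme for the exponential of a bounded operator *)

Section LinearFunctional.
Context {R : realType} {T : Type}.

Definition linear_functional (Phi : (T -> R) -> R) : Prop :=
  forall c f g, Phi (fun x => c * f x + g x) = c * Phi f + Phi g.

Lemma linear_functional_sum Phi (I : Type) (s : seq I) (c : I -> R)
    (g : I -> T -> R) : linear_functional Phi ->
  Phi (fun x => \sum_(i <- s) c i * g i x) = \sum_(i <- s) c i * Phi (g i).
Proof.
move=> lin; elim: s => [|i s IH].
  under eq_fun do rewrite big_nil.
  (* This instance yields [Phi 0 = 0]. *)
  have := lin (-1) (fun=> 0) (fun=> 0).
  under eq_fun do rewrite mulr0 addr0.
  by rewrite big_nil mulN1r addNr.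
under eq_fun do rewrite big_cons.
by rewrite lin IH big_cons.
Qed.

End LinearFunctional.

Section Euler.
Local Open Scope classical_set_scope.
Local Open Scope ring_scope.
Context {R : realType} {T : Type}.
Implicit Types (f g : T -> R) (t : R) (A : (T -> R) -> T -> R).

(** With [y = b / n.+1%:R], raise [expR (y / (1 + y)) <= 1 + y <= expR y] to the power [n.+1] and
    squeeze. *)
Lemma cvg_Euler_expR (b : R) : 0 <= b ->
  (1 + b / n.+1%:R) ^+ n.+1 @[n --> \oo] --> expR b.
Proof.
move=> b0.
have y0 n : 0 <= b / n.+1%:R by rewrite divr_ge0.
apply: (@squeeze_cvgr _ _ _ _ (fun n => expR (b / (1 + b / n.+1%:R)))
  (fun=> expR b)); last 2 first.
- apply: continuous_cvg; first exact: continuous_expR.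
  rewrite -[X in _ --> X]divr1; apply: cvgMl_tmp; apply: cvgV; first exact: oner_neq0.
  rewrite -[X in _ --> X]addr0; apply: cvgD; first exact: cvg_cst.
  by rewrite -[X in _ --> X](mulr0 b); apply: cvgMl_tmp; exact: cvg_harmonic.
- exact: cvg_cst.
apply: nearW => n; set y := b / n.+1%:R.
have y1 : 0 < 1 + y by rewrite ltr_pwDl ?y0.
have by_ : b = n.+1%:R * y by rewrite /y mulrC divfK.
apply/andP; split.
  rewrite by_ -mulrA expRM_natl ler_pXn2r ?nnegrE ?expR_ge0 ?(ltW y1)//.
  rewrite -[leLHS]invrK -expRN -[leRHS]invrK.
  rewrite lef_pV2 ?posrE ?invr_gt0 ?expR_gt0//.
  apply: le_trans (expR_ge1Dx _).
  by rewrite le_eqVlt; apply/orP; left; apply/eqP; field; rewrite gt_eqF.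
rewrite [X in expR X]by_ expRM_natl ler_pXn2r ?nnegrE ?expR_ge0 ?(ltW y1)//.
exact: expR_ge1Dx.
Qed.

Context (A : (T -> R) -> T -> R) (a : R).
Context (A_lin : forall x, linear_functional (fun f => A f x)).
Context (A_bound : forall f b, (forall x, `|f x| <= b) ->
  forall x, `|A f x| <= a * b).

(** Positivity and contraction cannot be read off the power series of the semigroup. For the
    zero-range generator a small Euler step has them, and they survive in the limit. *)
Definition Euler_step (c : R) f : T -> R := fun x => f x + c * A f x.

(** Binomial theorem for the operator [1 + c * A]; the induction is Pascal's rule. *)
Lemma iter_Euler_step c n f x : iter n (Euler_step c) f x =
  \sum_(j < n.+1) 'C(n, j)%:R * c ^+ j * iter j A f x.
Proof.
elim: n x => [|n IH] x; first by rewrite big_ord1 bin0 expr0 !mul1r.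
have -> : iter n.+1 (Euler_step c) f x =
    Euler_step c (fun x => \sum_(j < n.+1) 'C(n, j)%:R * c ^+ j * iter j A f x) x.
  by rewrite iterS; congr Euler_step; apply/funext => y; exact: IH.
rewrite /Euler_step (linear_functional_sum _
  (fun j : 'I_n.+1 => 'C(n, j)%:R * c ^+ j) (fun j => iter j A f) (A_lin x)).
rewrite [RHS]big_ord_recl.
under [X in _ = _ + X]eq_bigr => j _ do
  rewrite lift0 binS natrD mulrDl mulrDl.
rewrite big_split /= addrA; congr (_ + _).
  rewrite [X in _ = _ + X]big_ord_recr /= (@bin_small n n.+1)// !mul0r addr0.
  by rewrite big_ord_recl !bin0.
rewrite mulr_sumr; apply: eq_bigr => j _ /=; rewrite exprS; ring.
Qed.

(** The product of ['C(n, j)] and [j!] is a falling factorial, at most [n ^ j]. Hence no coefficient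
    of the Euler scheme exceeds that of the exponential series, and the differences have a constant
    sign. *)
Lemma bin_le_expn_fact n j : 'C(n, j)%:R / n%:R ^+ j <= (j`!%:R)^-1 :> R.
Proof.
have [->|n0] := posnP n.
  case: j => [|j]; rewrite bin0n /= ?mul0r ?invr_ge0 ?ler0n//.
  by rewrite expr0 divr1 fact0 invr1.
rewrite ler_pdivrMr ?exprn_gt0 ?ltr0n// mulrC ler_pdivlMr ?ltr0n ?fact_gt0//.
rewrite -natrM -natrX ler_nat bin_ffact.
elim: j n {n0} => [|j IH] n //; rewrite ffactnS expnS leq_mul2l.
apply/orP; right; apply: leq_trans (IH _) _.
by case: j {IH} => // j; rewrite leq_exp2r ?leq_pred.
Qed.

Lemma iter_bound f b : (forall x, `|f x| <= b) ->
  forall j x, `|iter j A f x| <= a ^+ j * b.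
Proof.
move=> fb; elim=> [|j IH] x; first by rewrite mul1r.
by rewrite iterS exprS -mulrA; exact: A_bound.
Qed.

(* Coefficientwise, the distance between the Euler scheme and the exponential
   series is dominated by the same distance for the scalar [a * t]. *)
Lemma cvg_Euler f b t : 0 <= a -> 0 <= t -> (forall x, `|f x| <= b) ->
  forall x, iter n (Euler_step (t / n%:R)) f x @[n --> \oo] -->
    limn (series (fun k => t ^+ k / k`!%:R * iter k A f x)).
Proof.
move=> a0 t0 fb x; set u := (X in series X).
have b0 : 0 <= b by exact: le_trans (fb x).
have ub k : `|u k| <= b * exp_coeff (a * t) k.
  rewrite /u normrM ger0_norm ?divr_ge0 ?exprn_ge0//.
  apply: le_trans (ler_wpM2l _ (iter_bound fb k x)) _.
    by rewrite divr_ge0 ?exprn_ge0.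
  by rewrite /exp_coeff /= exprMn le_eqVlt; apply/orP; left; apply/eqP; ring.
have cu : cvgn (series u).
  apply: normed_cvg.
  apply: (@series_le_cvg _ _ (fun k => b * exp_coeff (a * t) k)) => //.
  - by move=> k; exact: normr_ge0.
  - by move=> k; apply: le_trans (ub k).
  - rewrite (_ : series _ = (fun n => b * series (exp_coeff (a * t)) n)).
    by apply: is_cvgMl_tmp; exact: is_cvg_series_exp_coeff.
  by apply/funext => n; rewrite /series /= mulr_sumr.
have sh2 (v : R^nat) (l : R) : v @ \oo --> l -> v n.+2 @[n --> \oo] --> l.
  by move=> ?; do 2! rewrite (cvg_shiftS (fun n => v _)).
(* The shift avoids a zero number of steps; [n.+1] steps expand into [n.+2] terms, hence the partial
   sum of that length. *)
rewrite -cvg_shiftS; apply: (cvg_sub0 _ (sh2 _ _ cu)); apply/norm_cvg0P.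
apply: (@squeeze_cvgr _ _ _ _ (fun=> 0) (fun n => b *
  (series (exp_coeff (a * t)) n.+2 - (1 + a * t / n.+1%:R) ^+ n.+1))); first 1 last.
- exact: cvg_cst.
- rewrite -[X in _ --> X](mulr0 b) -(subrr (expR (a * t))).
  apply: cvgMl_tmp; apply: cvgB; last by apply: cvg_Euler_expR; exact: mulr_ge0.
  apply: (sh2 (series _)); exact: is_cvg_series_exp_coeff.
apply: nearW => n; rewrite normr_ge0 !fctE /= -iterS iter_Euler_step exprDn.
rewrite /series /= !big_mkord -!sumrB mulr_sumr.
apply: le_trans (ler_norm_sum _ _ _) _; apply: ler_sum => j _.
set N := n.+1; have N0 : (N%:R : R) != 0 by rewrite pnatr_eq0.
have -> : 'C(N, j)%:R * (t / N%:R) ^+ j * iter j A f x - u j =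
  - (t ^+ j * ((j`!%:R)^-1 - 'C(N, j)%:R / N%:R ^+ j) * iter j A f x).
  by rewrite /u expr_div_n; ring.
have d0 : 0 <= t ^+ j * ((j`!%:R)^-1 - 'C(N, j)%:R / N%:R ^+ j).
  by rewrite mulr_ge0 ?exprn_ge0// subr_ge0 bin_le_expn_fact.
rewrite normrN normrM (ger0_norm d0).
apply: le_trans (ler_wpM2l d0 (iter_bound fb j x)) _.
rewrite expr1n mul1r /exp_coeff /= expr_div_n exprMn -mulr_natr.
by rewrite le_eqVlt; apply/orP; left; apply/eqP; ring.
Qed.

End Euler.

(** * Configurations *)

Section Configurations.
Context {m n : nat}.
Implicit Types (x y : zrp_state m n) (i j k l : 'I_n).

Lemma occ_inj x y : (forall i, occ x i = occ y i) -> x = y.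
Proof. by move=> xy; apply/val_inj/ffunP => i; apply/val_inj/xy. Qed.

Lemma sum_occ x : (\sum_i occ x i)%N = m.
Proof. exact/eqP/(valP x). Qed.

Lemma occ_le x i : (occ x i <= m)%N.
Proof. by rewrite -ltnS ltn_ord. Qed.

Lemma occ_jump_gt0 x i j : (0 < occ x i)%N -> (0 < occ (jump x i j) j)%N.
Proof.
move=> xi; have := occ_jump j j xi; rewrite eqxx.
by case: eqVneq xi => [->|_]; lia.
Qed.

Lemma jump_id x i : (0 < occ x i)%N -> jump x i i = x.
Proof. by move=> xi; apply: occ_inj => k; have := occ_jump i k xi; lia. Qed.

Lemma jump_jump x i j l : (0 < occ x i)%N -> jump (jump x i j) j l = jump x i l.
Proof.
move=> xi; apply: occ_inj => k.
have := occ_jump j k xi; have := occ_jump l k xi.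
by have := occ_jump l k (occ_jump_gt0 j xi); lia.
Qed.

Lemma jumpK x i j : (0 < occ x i)%N -> jump (jump x i j) j i = x.
Proof. by move=> xi; rewrite jump_jump ?jump_id. Qed.

(** Taking the moved particle away, before or after the jump, leaves the same other particles. *)
Lemma occ_jump_sub x i j k : (0 < occ x i)%N ->
  (occ (jump x i j) k - (k == j) = occ x k - (k == i))%N.
Proof.
move=> xi; have := occ_jump_gt0 j xi; have := occ_jump j k xi.
by case: (eqVneq k i) xi => [<-|_]; case: (eqVneq k j) => [<-|_]; lia.
Qed.

(* Two distinct particles, on sites [i] and [k], jump independently. *)
Lemma occ_jump_other x i k l : (0 < occ x i)%N -> ((k == i) < occ x k)%N ->
  (0 < occ (jump x k l) i)%N.
Proof.
move=> xi xk; have xk0 : (0 < occ x k)%N by exact: leq_ltn_trans xk.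
have := occ_jump l i xk0; rewrite [i == k]eq_sym.
by case: eqVneq xk => [->|_]; lia.
Qed.

(** The condition [(k == i) < occ x k] grants site [k] a particle besides the one taken from [i], so
    two of them when [k = i]. *)
Lemma jumpC x i j k l : (0 < occ x i)%N -> ((k == i) < occ x k)%N ->
  jump (jump x k l) i j = jump (jump x i j) k l.
Proof.
move=> xi xk; have xk0 : (0 < occ x k)%N by exact: leq_ltn_trans xk.
have xik : (0 < occ (jump x i j) k)%N.
  by have := occ_jump j k xi; lia.
apply: occ_inj => q.
have := occ_jump j q (occ_jump_other l xi xk); have := occ_jump l q xk0.
by have := occ_jump l q xik; have := occ_jump j q xi; lia.
Qed.

Definition adjacent : rel (zrp_state m n) :=
  fun x y => [exists i, exists j, (0 < occ x i)%N && (y == jump x i j)].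

Lemma adjacentP x y :
  reflect (exists i j, (0 < occ x i)%N /\ y = jump x i j) (adjacent x y).
Proof.
apply: (iffP existsP) => [[i /existsP[j /andP[xi /eqP ->]]]|[i [j [xi ->]]]].
  by exists i, j.
by exists i; apply/existsP; exists j; rewrite xi eqxx.
Qed.

Lemma adjacent_jump x i j : (0 < occ x i)%N -> adjacent x (jump x i j).
Proof. by move=> xi; apply/adjacentP; exists i, j. Qed.

Lemma adjacent_sym x y : adjacent x y -> adjacent y x.
Proof.
move=> /adjacentP[i [j [xi ->]]]; apply/adjacentP; exists j, i.
by rewrite occ_jump_gt0 ?jumpK.
Qed.

Lemma adjacent_refl x : (0 < m)%N -> adjacent x x.
Proof.
move=> m0; have [i xi] : exists i, (0 < occ x i)%N.
  apply/existsP; apply: contraLR m0; rewrite negb_exists => /forallP x0.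
  by rewrite -(sum_occ x) big1 // => i _; have := x0 i; rewrite -eqn0Ngt => /eqP.
by rewrite -{2}(jump_id xi) adjacent_jump.
Qed.

(** Moving particles one at a time from sites in excess to sites in deficit joins [x] to [y] in at
    most [m] moves; idle moves, allowed by [adjacent_refl], fill up any larger [N]. This serves both
    the diameter bound and the positivity of the kernel. *)
Lemma adjacent_ind y (Q : nat -> zrp_state m n -> Prop) : (0 < m)%N ->
  Q 0%N y -> (forall N x x', adjacent x x' -> Q N x' -> Q N.+1 x) ->
  forall N x, (m <= N)%N -> Q N x.
Proof.
move=> m0 Q0 QS.
(* Truncated subtraction makes this sum count the particles in excess. *)
have H N : forall x, (\sum_i (occ x i - occ y i) <= N)%N -> Q N x.
  elim: N => [|N IH] x.
    rewrite leqn0 sum_nat_eq0 => /forallP xy.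
    suff -> : x = y by [].
    have le_xy i : (occ x i <= occ y i)%N by have := xy i; rewrite subn_eq0.
    apply: occ_inj => i; apply/eqP; rewrite eqn_leq le_xy /= leqNgt; apply/negP => lt_xy.
    have := sum_occ x; rewrite -[RHS](sum_occ y); apply/eqP; rewrite ltn_eqF//.
    by rewrite (bigD1 i) //= [ltnRHS](bigD1 i)//= -addSn leq_add// leq_sum.
  have [S0 _|S0 SN] := posnP (\sum_i (occ x i - occ y i))%N.
    by apply: QS (adjacent_refl x m0) _; apply: IH; rewrite S0.
  have [i yx] : exists i, (occ y i < occ x i)%N.
    apply/existsP; apply: contraLR S0; rewrite negb_exists => /forallP x0.
    by rewrite -eqn0Ngt sum_nat_eq0; apply/forallP => i; rewrite subn_eq0 leqNgt x0.
  have [j xy] : exists j, (occ x j < occ y j)%N.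
    apply/existsP; rewrite -[X in is_true X]negbK negb_exists; apply/negP => /forallP x0.
    have := sum_occ y; rewrite -[RHS](sum_occ x); apply/eqP; rewrite ltn_eqF//.
    rewrite (bigD1 i) //= [ltnRHS](bigD1 i)//= -addSn leq_add// leq_sum// => k _.
    by rewrite leqNgt x0.
  have xi : (0 < occ x i)%N by exact: leq_ltn_trans yx.
  apply: QS (adjacent_jump j xi) _; apply: IH.
  have ij : i != j by apply: contraTneq xy => <-; rewrite -leqNgt ltnW.
  rewrite -ltnS; apply: leq_trans SN.
  rewrite [ltnRHS](bigD1 i)//= (bigD1 i)//= -addSn leq_add//.
    by have := occ_jump j i xi; rewrite eqxx (negbTE ij); lia.
  apply: leq_sum => k ki; have := occ_jump j k xi; rewrite (negbTE ki).
  by case: eqP => [->|_]; lia.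
move=> N x mN; apply: H; apply: leq_trans mN.
by rewrite -[leqRHS](sum_occ x) leq_sum// => i _; rewrite leq_subr.
Qed.

End Configurations.

(** * Generator and semigroup of the zero-range process *)

Lemma cvgn_unique {R : realType} (u : nat -> R) (l l' : R) :
  (u @ \oo --> l -> u @ \oo --> l' -> l = l')%classic.
Proof. exact: norm_cvg_unique. Qed.

Section Generator.
Context {R : realType} {m n : nat}.
Context (nu : 'I_n -> R) (r : 'I_n -> nat -> R).
Implicit Types (x y : zrp_state m n) (i j k : 'I_n) (f g : zrp_state m n -> R).

Let L f x := zrp_gen r nu f x.
Let M c := Euler_step (zrp_gen r nu (m := m)) c.

Lemma zrp_gen_linear x : linear_functional (L ^~ x).
Proof.
move=> c f g; rewrite /L /zrp_gen mulr_sumr -big_split /=.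
apply: eq_bigr => i _; rewrite mulr_sumr -big_split /=.
by apply: eq_bigr => j _; ring.
Qed.

Lemma zrp_gen_bound f b : (forall x, `|f x| <= b) -> forall x,
  `|L f x| <=
    (\sum_(y : zrp_state m n) \sum_i \sum_j `|r i (occ y i) * nu j| * 2) * b.
Proof.
move=> fb x; have b0 : 0 <= b by exact: le_trans (fb x).
rewrite mulr_suml (bigD1 x)//= ler_wpDr//.
  apply: sumr_ge0 => y _; rewrite mulr_ge0//.
  by apply: sumr_ge0 => i _; apply: sumr_ge0 => j _; rewrite mulr_ge0.
apply: le_trans (ler_norm_sum _ _ _) _; rewrite mulr_suml; apply: ler_sum => i _.
apply: le_trans (ler_norm_sum _ _ _) _; rewrite mulr_suml; apply: ler_sum => j _.
rewrite normrM -mulrA ler_wpM2l// (le_trans (ler_normB _ _))//.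
by rewrite mulr_natl mulr2n lerD.
Qed.

Lemma zrp_semigroup_cvg t f x : 0 <= t ->
  (iter N (M (t / N%:R)) f x @[N --> \oo] --> zrp_semigroup r nu t f x)%classic.
Proof.
move=> t0; apply: (cvg_Euler zrp_gen_linear zrp_gen_bound _ t0
  (b := \sum_y `|f y|)).
  apply: sumr_ge0 => y _; apply: sumr_ge0 => i _.
  by apply: sumr_ge0 => j _; rewrite mulr_ge0.
by move=> y; rewrite (bigD1 y)//= ler_wpDr// sumr_ge0.
Qed.

Lemma Euler_step_linear c f g a x :
  M c (fun y => a * f y + g y) x = a * M c f x + M c g x.
Proof.
have E := zrp_gen_linear x a f g; rewrite /L in E.
by rewrite /M /Euler_step E; ring.
Qed.

Lemma iter_Euler_linear c N f g a :
  iter N (M c) (fun y => a * f y + g y) =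
  (fun x => a * iter N (M c) f x + iter N (M c) g x).
Proof.
elim: N => [//|N IH]; rewrite iterS IH; apply/funext => x.
exact: Euler_step_linear.
Qed.

Lemma zrp_semigroup_linear t x : 0 <= t ->
  linear_functional (fun f : zrp_state m n -> R => zrp_semigroup r nu t f x).
Proof.
move=> t0 c f g.
apply: (cvgn_unique (@zrp_semigroup_cvg t _ x t0)).
under eq_fun do rewrite iter_Euler_linear.
by apply: cvgD; [apply: cvgMl_tmp|]; exact: zrp_semigroup_cvg.
Qed.

Lemma zrp_semigroup_kernel t f x : 0 <= t ->
  zrp_semigroup r nu t f x =
  mean (fun y => zrp_semigroup r nu t (fun z => (z == y)%:R) x) f.
Proof.
move=> t0; rewrite /mean; under eq_bigr do rewrite mulrC.
rewrite -(linear_functional_sum _ _ _ (zrp_semigroup_linear x t0)).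
congr zrp_semigroup; apply/funext => z.
by rewrite (bigD1 z)//= eqxx mulr1 big1 ?addr0// => y /negbTE zy; rewrite eq_sym zy mulr0.
Qed.

Lemma zrp_semigroup_cst t a x : 0 <= t ->
  zrp_semigroup r nu t (fun=> a) x = a.
Proof.
move=> t0; apply: (cvgn_unique (@zrp_semigroup_cvg t _ x t0)).
suff E c N : iter N (M c) (fun=> a) x = a.
  by under eq_fun do rewrite E; exact: cvg_cst.
have Ma : M c (fun=> a) = fun=> a.
  apply/funext => y; rewrite /M /Euler_step /zrp_gen big1 ?mulr0 ?addr0// => i _.
  by rewrite big1// => j _; rewrite subrr mulr0.
suff -> : iter N (M c) (fun=> a) = fun=> a by [].
by elim: N => // N; rewrite iterS => ->.
Qed.

Section Reversible.
Context (w : zrp_state m n -> R).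
Context (r0 : forall i, r i 0%N = 0).
Context (balance : forall x i j, (0 < occ x i)%N ->
  w x * (r i (occ x i) * nu j) =
  w (jump x i j) * (r j (occ (jump x i j) j) * nu i)).

Lemma mean_zrp_gen f g : mean w (fun x => g x * L f x) = mean w (fun x => L g x * f x).
Proof.
(* Detailed balance as a symmetric identity over all pairs of states; at an empty site [jump] is a
   default value, but the rate vanishes by [r0]. *)
have bal x y i j :
    w x * (r i (occ x i) * nu j) * (y == jump x i j)%:R =
    w y * (r j (occ y j) * nu i) * (x == jump y j i)%:R.
  have H u v k l : (0 < occ u k)%N -> v = jump u k l ->
      w u * (r k (occ u k) * nu l) * (v == jump u k l)%:R =
      w v * (r l (occ v l) * nu k) * (u == jump v l k)%:R.
    by move=> uk ->; rewrite jumpK// !eqxx balance.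
  case: (posnP (occ x i)) => [xi0|xi].
    case: (posnP (occ y j)) => [yj0|yj]; first by rewrite xi0 yj0 !r0 !mul0r !mulr0 !mul0r.
    case: (eqVneq x (jump y j i)) => [xE|_].
      by have := occ_jump_gt0 i yj; rewrite -xE xi0.
    by rewrite xi0 r0 !mul0r !mulr0 !mul0r.
  case: (eqVneq y (jump x i j)) => [yE|yN]; first by rewrite -H ?yE ?eqxx.
  case: (eqVneq x (jump y j i)) => [xE|_]; last by rewrite !mulr0.
  have [yj0|yj] := posnP (occ y j); first by rewrite yj0 r0 !mul0r !mulr0 !mul0r.
  by move: yN; rewrite xE jumpK// eqxx.
have S (f' g' : zrp_state m n -> R) i j :
    \sum_x w x * (r i (occ x i) * nu j) * (g' x * f' (jump x i j)) =
    \sum_x w x * (r j (occ x j) * nu i) * (g' (jump x j i) * f' x).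
  have E x : w x * (r i (occ x i) * nu j) * (g' x * f' (jump x i j)) =
      \sum_y w x * (r i (occ x i) * nu j) * (y == jump x i j)%:R * (g' x * f' y).
    rewrite (bigD1 (jump x i j))//= eqxx mulr1 big1 ?addr0// => y /negbTE ->.
    by rewrite mulr0 mul0r.
  under eq_bigr do rewrite E.
  rewrite exchange_big /=; apply: eq_bigr => y _.
  under eq_bigr do rewrite bal.
  rewrite (bigD1 (jump y j i))//= eqxx mulr1 big1 ?addr0// => x /negbTE ->.
  by rewrite mulr0 mul0r.
(* Gain and loss parts: [S] exchanges [i] and [j] in the former, and the latter is symmetric in [f]
   and [g]. *)
have D (f' g' : zrp_state m n -> R) : mean w (fun x => g' x * L f' x) =
    \sum_i \sum_j \sum_x w x * (r i (occ x i) * nu j) * (g' x * f' (jump x i j)) -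
    \sum_i \sum_j \sum_x w x * (r i (occ x i) * nu j) * (g' x * f' x).
  rewrite -sumrB; under [RHS]eq_bigr do rewrite -sumrB.
  under [RHS]eq_bigr do under eq_bigr do rewrite -sumrB.
  under [RHS]eq_bigr do rewrite exchange_big.
  rewrite exchange_big; apply: eq_bigr => x _ /=.
  rewrite /L /zrp_gen mulr_sumr mulr_sumr; apply: eq_bigr => i _.
  by rewrite !mulr_sumr; apply: eq_bigr => j _; ring.
rewrite D; under [RHS]eq_mean do rewrite mulrC; rewrite D.
congr (_ - _); last first.
  by do 2!(apply: eq_bigr => ? _); apply: eq_bigr => x _; rewrite [f x * _]mulrC.
rewrite exchange_big; apply: eq_bigr => i _; apply: eq_bigr => j _.
by rewrite S; apply: eq_bigr => x _; rewrite [f x * _]mulrC.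
Qed.

(** Each Euler step is symmetric, hence so are its iterates and their limit. *)
Lemma mean_zrp_semigroup t f g : 0 <= t ->
  mean w (fun x => g x * zrp_semigroup r nu t f x) =
  mean w (fun x => zrp_semigroup r nu t g x * f x).
Proof.
move=> t0.
have cv (f' g' : zrp_state m n -> R) :
    (mean w (fun x => g' x * iter N (M (t / N%:R)) f' x) @[N --> \oo] -->
     mean w (fun x => g' x * zrp_semigroup r nu t f' x))%classic.
  apply: cvg_big; first exact: add_continuous.
  move=> x _; do 2!apply: cvgMl_tmp; exact: zrp_semigroup_cvg.
under [RHS]eq_mean do rewrite mulrC.
apply: (cvgn_unique (cv f g)).
suff E c N f' g' : mean w (fun x => g' x * iter N (M c) f' x) =
    mean w (fun x => f' x * iter N (M c) g' x).
  by under eq_fun do rewrite E; exact: cv.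
elim: N f' g' => [|N IH] f' g'; first by apply: eq_mean => x; rewrite mulrC.
rewrite iterS iterSr -IH /M /Euler_step.
under eq_mean do rewrite mulrDr mulrCA; rewrite meanD meanZ mean_zrp_gen.
rewrite -meanZ -meanD; apply: eq_mean => x; rewrite /L; ring.
Qed.

End Reversible.
End Generator.

(** * Coupling and contraction for one Euler step *)

Section Curvature.
Context {R : realType} {m n : nat}.
Context (nu : 'I_n -> R) (r : 'I_n -> nat -> R) (delta : R).
Implicit Types (x y : zrp_state m n) (i j k : 'I_n) (f g : zrp_state m n -> R).
Context (nu_law : is_law nu) (r0 : forall i, r i 0%N = 0).
Context (r_ge0 : forall i q, 0 <= r i q) (delta_ge0 : 0 <= delta).
Context (r_incr : forall i q, (1 <= q <= m)%N -> delta <= r i q - r i q.-1).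

Let M c := Euler_step (zrp_gen r nu (m := m)) c.

Definition exit_rate x : R := \sum_k r k (occ x k).

(** The mean of [f] after a particle of site [i] is relocated according to [nu]. It forgets where
    that particle stood, which is what merges two coupled particles. *)
Let resample f x i : R := mean nu (fun j => f (jump x i j)).

Lemma zrp_genE f x :
  zrp_gen r nu f x = \sum_k r k (occ x k) * (resample f x k - f x).
Proof.
apply: eq_bigr => i _; rewrite -[in RHS](mean_cst (f x) nu_law) -meanB.
by rewrite mulr_sumr; apply: eq_bigr => j _; rewrite mulrA.
Qed.

(* Splits off one particle of site [i], which jumps at the rate
   [r i (occ x i) - r i (occ x i).-1] left over by the other particles. *)
Lemma sum_rate_split (h : 'I_n -> R) x i : (0 < occ x i)%N ->
  \sum_k r k (occ x k) * h k =
  \sum_k r k (occ x k - (k == i))%N * h k +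
  (r i (occ x i) - r i (occ x i).-1) * h i.
Proof.
move=> xi; rewrite (bigD1 i)//= [in RHS](bigD1 i)//= eqxx subn1.
under [X in _ = _ + X + _]eq_bigr => k /negbTE ki do rewrite ki subn0.
ring.
Qed.

(** For such [c] the step is a mixture of staying put and relocating one particle. *)
Lemma Euler_step_ge0 c f : 0 <= c -> (forall x, c * exit_rate x <= 1) ->
  (forall x, 0 <= f x) -> forall x, 0 <= M c f x.
Proof.
move=> c0 cr f0 x.
have -> : M c f x = (1 - c * exit_rate x) * f x +
    c * \sum_k r k (occ x k) * resample f x k.
  rewrite /M /Euler_step zrp_genE /exit_rate.
  by under eq_bigr do rewrite mulrBr; rewrite sumrB -mulr_suml; ring.
rewrite addr_ge0 ?mulr_ge0 ?subr_ge0//.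
apply: sumr_ge0 => k _; rewrite mulr_ge0//.
by apply: sumr_ge0 => j _; rewrite mulr_ge0// (proj1 nu_law).
Qed.

Lemma Euler_step_scale c C f x : M c (fun y => C * f y) x = C * M c f x.
Proof.
rewrite /M; have := Euler_step_linear nu r c f (fun=> 0) C x.
have -> : (fun y => C * f y + 0) = (fun y => C * f y).
  by apply/funext => y; rewrite addr0.
move=> ->; rewrite -[RHS]addr0; congr (_ + _).
rewrite /Euler_step add0r zrp_genE big1 ?mulr0// => k _.
by rewrite /resample mean_cst// subrr mulr0.
Qed.

(* Two configurations which differ by the position of one particle are coupled
   so that all other particles move together, while the two distinguished
   particles merge at rate at least [delta].  The assumption on [(C - 1) * f]
   covers both [C = 1] and [1 <= C] with [0 <= f]. *)
Lemma Euler_step_adjacent c C l f : 0 <= c -> 0 <= l ->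
  (forall x, c * exit_rate x <= 1) -> (forall x, 0 <= (C - 1) * f x) ->
  (forall x y, adjacent x y -> f x <= C * f y + l) ->
  forall x y, adjacent x y -> M c f x <= C * M c f y + (1 - c * delta) * l.
Proof.
move=> c0 l0 cr Cf fl x y xy; have fxy := fl _ _ xy.
move/adjacentP: xy => [i [j [xi yE]]].
have yj : (0 < occ y j)%N by rewrite yE occ_jump_gt0.
have xyocc k : (occ y k - (k == j) = occ x k - (k == i))%N.
  by rewrite yE occ_jump_sub.
(* Rates of the common particles, the same for [x] and [y]; [s] and [s'] are the rates left to the
   two distinguished particles. *)
pose a k := r k (occ x k - (k == i))%N.
have a0 k : 0 <= a k by exact: r_ge0.
set s := r i (occ x i) - r i (occ x i).-1.
set s' := r j (occ y j) - r j (occ y j).-1.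
have sd : delta <= s by apply: r_incr; rewrite xi occ_le.
have sd' : delta <= s' by apply: r_incr; rewrite yj occ_le.
set F := resample f x i.
have FE : resample f y j = F.
  by apply: eq_mean => k; rewrite yE jump_jump.
have rx h : \sum_k r k (occ x k) * h k = \sum_k a k * h k + s * h i.
  exact: sum_rate_split.
have ry h : \sum_k r k (occ y k) * h k = \sum_k a k * h k + s' * h j.
  by rewrite (sum_rate_split _ yj); under eq_bigr do rewrite xyocc.
set A := \sum_k a k.
have Ax : c * (A + s) <= 1.
  have := cr x; rewrite /exit_rate; have := rx (fun=> 1).
  by under eq_bigr do rewrite mulr1; under [X in _ = X + _]eq_bigr do rewrite mulr1;
    rewrite mulr1 => ->.
have Ay : c * (A + s') <= 1.
  have := cr y; rewrite /exit_rate; have := ry (fun=> 1).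
  by under eq_bigr do rewrite mulr1; under [X in _ = X + _]eq_bigr do rewrite mulr1;
    rewrite mulr1 => ->.
have LE z u : \sum_k a k * (resample f z k - u) =
    \sum_k a k * resample f z k - A * u.
  by under eq_bigr do rewrite mulrBr; rewrite sumrB -mulr_suml.
rewrite /M /Euler_step !zrp_genE rx ry FE -/F !LE.
set Sx := \sum_k _; set Sy := \sum_k _.
(* A common particle jumps to the same site in both configurations, which stay adjacent; a site
   without common particles has rate zero. *)
have S_le : Sx <= C * Sy + A * l.
  rewrite /Sx /Sy /A mulr_sumr mulr_suml -big_split /=; apply: ler_sum => k _.
  have [k0|k0] := posnP (occ x k - (k == i)); first by rewrite /a k0 r0; lra.
  rewrite mulrCA -mulrDr ler_wpM2l//.
  rewrite -meanZ -[X in _ + X](mean_cst l nu_law) -meanD.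
  apply: le_mean => [q|q]; first exact: (proj1 nu_law).
  have xk : ((k == i) < occ x k)%N by rewrite -subn_gt0.
  by apply: fl; rewrite yE -jumpC// adjacent_jump ?occ_jump_other.
(* Here only the distinguished particle of [x] jumps, in [F_ge] only that of [y]. *)
have F_le : F <= C * f y + l.
  rewrite /F -[X in _ <= X](mean_cst _ nu_law); apply: le_mean => [q|q].
    exact: (proj1 nu_law).
  apply: fl; apply: adjacent_sym.
  by rewrite -(jump_jump j q xi) -yE adjacent_jump.
have F_ge : f x <= C * F + l.
  rewrite /F -meanZ -[X in _ + X](mean_cst l nu_law) -meanD.
  rewrite -[X in X <= _](mean_cst _ nu_law); apply: le_mean => [q|q].
    exact: (proj1 nu_law).
  by apply: fl; exact: adjacent_jump.
have F_C : 0 <= (C - 1) * F.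
  rewrite /F -meanZ; apply: sumr_ge0 => q _.
  by rewrite mulr_ge0// (proj1 nu_law).
have hS : 0 <= c * (C * Sy + A * l - Sx) by rewrite mulr_ge0 ?subr_ge0.
(* The events of the coupling: [h1], no jump; [h2], the faster distinguished particle jumps alone;
   [h3], both jump and merge, at rate the minimum of [s] and [s'], which is at least [delta] ([h4]);
   [hS], a common particle jumps. *)
have [ss|ss] := leP s' s.
- have h1 : 0 <= (1 - c * (A + s)) * (C * f y + l - f x) by rewrite mulr_ge0 ?subr_ge0.
  have h2 : 0 <= c * (s - s') * (C * f y + l - F) by rewrite !mulr_ge0 ?subr_ge0.
  have h3 : 0 <= c * s' * ((C - 1) * F).
    by rewrite mulr_ge0// mulr_ge0// (le_trans delta_ge0).
  have h4 : 0 <= c * (s' - delta) * l by rewrite !mulr_ge0 ?subr_ge0.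
  lra.
- have h1 : 0 <= (1 - c * (A + s')) * (C * f y + l - f x) by rewrite mulr_ge0 ?subr_ge0.
  have h2 : 0 <= c * (s' - s) * (C * F + l - f x).
    by rewrite !mulr_ge0 ?subr_ge0 ?(ltW ss).
  have h3 : 0 <= c * s * ((C - 1) * F).
    by rewrite mulr_ge0// mulr_ge0// (le_trans delta_ge0).
  have h4 : 0 <= c * (s - delta) * l by rewrite !mulr_ge0 ?subr_ge0.
  lra.
Qed.

End Curvature.

(** * Contraction and strict positivity of the semigroup *)

Section Semigroup.
Local Open Scope classical_set_scope.
Local Open Scope ring_scope.
Context {R : realType} {m n : nat}.
Context (nu : 'I_n -> R) (r : 'I_n -> nat -> R) (delta : R).
Implicit Types (x y : zrp_state m n) (i j k : 'I_n) (f g : zrp_state m n -> R).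
Context (nu_law : is_law nu) (r0 : forall i, r i 0%N = 0).
Context (r_ge0 : forall i q, 0 <= r i q) (delta_ge0 : 0 <= delta).
Context (r_incr : forall i q, (1 <= q <= m)%N -> delta <= r i q - r i q.-1).

Let M c := Euler_step (zrp_gen r nu (m := m)) c.
(** Dominates [delta] and all exit rates, so that [c * bound <= 1] is the only smallness condition
    on a step size [c]. *)
Let bound : R := \sum_(x : zrp_state m n) exit_rate r x + delta.

Lemma exit_rate_ge0 x : 0 <= exit_rate r x.
Proof. exact: sumr_ge0. Qed.

Lemma exit_rate_le_bound x : exit_rate r x <= bound.
Proof.
rewrite /bound (bigD1 x)//= -addrA ler_wpDr// addr_ge0// sumr_ge0// => y _.
exact: exit_rate_ge0.
Qed.

Lemma delta_le_bound : delta <= bound.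
Proof. by rewrite ler_wpDl// sumr_ge0// => x _; exact: exit_rate_ge0. Qed.

Lemma iter_Euler_step_ge0 c N f : 0 <= c -> c * bound <= 1 ->
  (forall x, 0 <= f x) -> forall x, 0 <= iter N (M c) f x.
Proof.
move=> c0 cb f0; elim: N => [//|N IH] x; apply: Euler_step_ge0 => // y.
by apply: le_trans cb; rewrite ler_wpM2l// exit_rate_le_bound.
Qed.

Lemma iter_Euler_step_adjacent c C l N f : 0 <= c -> c * bound <= 1 ->
  0 <= l -> (forall x, 0 <= (C - 1) * f x) ->
  (forall x y, adjacent x y -> f x <= C * f y + l) ->
  forall x y, adjacent x y ->
    iter N (M c) f x <= C * iter N (M c) f y + (1 - c * delta) ^+ N * l.
Proof.
move=> c0 cb l0 Cf fl.
have cr x : c * exit_rate r x <= 1.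
  by apply: le_trans cb; rewrite ler_wpM2l// exit_rate_le_bound.
have cd : 0 <= 1 - c * delta.
  by rewrite subr_ge0; apply: le_trans cb; rewrite ler_wpM2l// delta_le_bound.
(* The sign condition is carried along because the next step requires it. *)
suff [] : (forall x, 0 <= (C - 1) * iter N (M c) f x) /\
  (forall x y, adjacent x y ->
    iter N (M c) f x <= C * iter N (M c) f y + (1 - c * delta) ^+ N * l) by [].
elim: N => [|N [IHC IHl]]; first by split=> // x y xy; rewrite mul1r fl.
split=> [x|x y xy]; rewrite !iterS.
  by rewrite -Euler_step_scale//; exact: Euler_step_ge0.
rewrite exprS -mulrA.
by apply: Euler_step_adjacent => //; rewrite mulr_ge0// exprn_ge0.
Qed.

Lemma near_small_step (t z : R) : 0 <= t -> 0 <= z ->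
  (\forall N \near \oo, (0 < N)%N /\ t / N%:R * z <= 1).
Proof.
move=> t0 z0; near=> N.
have N0 : (0 : R) < N%:R by near: N; exact: nbhs_infty_gtr.
split; first by rewrite -(ltr0n R).
rewrite mulrAC ler_pdivrMr// mul1r ltW//.
by near: N; exact: nbhs_infty_gtr.
Unshelve. all: by end_near. Qed.

Lemma bound_ge0 : 0 <= bound.
Proof. exact: le_trans delta_le_bound. Qed.

Lemma expr_1B_le_expR (a : R) N : (0 < N)%N -> a / N%:R <= 1 ->
  (1 - a / N%:R) ^+ N <= expR (- a).
Proof.
move=> N0 aN; have -> : - a = N%:R * - (a / N%:R).
  by rewrite mulrN mulrC divfK// pnatr_eq0 -lt0n.
by rewrite expRM_natl ler_pXn2r ?nnegrE ?expR_ge0 ?subr_ge0// expR_ge1Dx.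
Qed.

(** For large [N] the step size [t / N] is admissible, and [(1 - delta * t / N) ^ N] is at most
    [expR (- delta * t)]. *)
Lemma zrp_semigroup_adjacent t C l f : 0 <= t -> 0 <= l ->
  (forall x, 0 <= (C - 1) * f x) ->
  (forall x y, adjacent x y -> f x <= C * f y + l) ->
  forall x y, adjacent x y ->
    zrp_semigroup r nu t f x <=
      C * zrp_semigroup r nu t f y + expR (- delta * t) * l.
Proof.
move=> t0 l0 Cf fl x y xy.
have cx := @zrp_semigroup_cvg _ _ _ nu r t f x t0.
have cy := @zrp_semigroup_cvg _ _ _ nu r t f y t0.
have cz : C * iter N (M (t / N%:R)) f y + expR (- delta * t) * l @[N --> \oo] -->
    C * zrp_semigroup r nu t f y + expR (- delta * t) * l.
  by apply: cvgD; [exact: cvgMl_tmp|exact: cvg_cst].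
apply: (ler_cvg_to cx cz).
near=> N.
have [N0 NB] : (0 < N)%N /\ t / N%:R * bound <= 1.
  by near: N; apply: near_small_step => //; exact: bound_ge0.
have c0 : 0 <= t / N%:R by rewrite divr_ge0.
apply: le_trans (iter_Euler_step_adjacent N c0 NB l0 Cf fl xy) _.
rewrite lerD2l ler_wpM2r//.
have -> : t / N%:R * delta = delta * t / N%:R by ring.
rewrite mulNr expr_1B_le_expR//; apply: le_trans NB.
have -> : delta * t / N%:R = t / N%:R * delta by ring.
by rewrite ler_wpM2l// delta_le_bound.
Unshelve. all: by end_near. Qed.

Lemma bernoulli (a : R) N : 0 <= a <= 1 -> 1 - N%:R * a <= (1 - a) ^+ N.
Proof.
move=> /andP[a0 a1]; elim: N => [|N IH]; first by rewrite mul0r subr0.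
have h : 0 <= (1 - a) ^+ N <= 1 by rewrite exprn_ge0 ?exprn_ile1 ?subr_ge0// gerBl.
rewrite exprS -natr1; case/andP: h => h0 h1; nra.
Qed.

Context (m_gt0 : (0 < m)%N) (nu_gt0 : forall i, 0 < nu i).
Context (r_gt0 : forall i q, (1 <= q)%N -> 0 < r i q).

Lemma min_rate_gt0 : exists2 s : R, 0 < s &
  forall x i j, (0 < occ x i)%N -> s <= r i (occ x i) * nu j.
Proof.
exists (\big[Num.min/1]_(u : zrp_state m n * 'I_n * 'I_n | (0 < occ u.1.1 u.1.2)%N)
  (r u.1.2 (occ u.1.1 u.1.2) * nu u.2)).
  elim/big_ind: _ => // [a b a0 b0|u u0]; first by rewrite lt_min a0.
  by rewrite mulr_gt0// r_gt0.
by move=> x i j xi; rewrite (bigmin_le_cond 1 (j := (x, i, j)))//.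
Qed.

Lemma Euler_step_ge_jump c s f : 0 <= c -> c * bound <= 1 ->
  (forall x i j, (0 < occ x i)%N -> s <= r i (occ x i) * nu j) ->
  (forall x, 0 <= f x) -> forall x y, adjacent x y ->
  (1 - c * bound) * f x + c * s * f y <= M c f x.
Proof.
move=> c0 cb sr f0 x y /adjacentP[i [j [xi ->]]].
have -> : M c f x = (1 - c * exit_rate r x) * f x +
    c * \sum_k \sum_q r k (occ x k) * nu q * f (jump x k q).
  rewrite /M /Euler_step zrp_genE// /exit_rate.
  under eq_bigr do rewrite mulrBr; rewrite sumrB -mulr_suml.
  under [X in _ = _ + _ * X]eq_bigr do under eq_bigr do rewrite -mulrA.
  by under [X in _ = _ + _ * X]eq_bigr do rewrite -mulr_sumr; rewrite /mean; ring.
have t0 k q : 0 <= r k (occ x k) * nu q * f (jump x k q).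
  by rewrite !mulr_ge0// ltW.
apply: lerD.
  by rewrite ler_wpM2r// lerD2l lerN2 ler_wpM2l// exit_rate_le_bound.
rewrite -mulrA ler_wpM2l// (bigD1 i)//= (bigD1 j)//= -addrA ler_wpDr ?addr_ge0 ?sumr_ge0//.
  by move=> k _; exact: sumr_ge0.
by rewrite ler_wpM2r// sr.
Qed.

(** The jump to [y] happens at one of [N] steps, and all others stay put. The exponent [N] instead
    of [N - 1] gives up a little to keep the induction simple. *)
Lemma iter_Euler_step_ge_jump c s f N : 0 <= c -> c * bound <= 1 -> 0 <= s ->
  (forall x i j, (0 < occ x i)%N -> s <= r i (occ x i) * nu j) ->
  (forall x, 0 <= f x) -> forall x y, adjacent x y ->
  N%:R * (c * s) * (1 - c * bound) ^+ N * f y <= iter N (M c) f x.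
Proof.
move=> c0 cb s0 sr f0 x y xy.
have b0 : 0 <= 1 - c * bound by rewrite subr_ge0.
have it0 q z : 0 <= iter q (M c) f z by exact: iter_Euler_step_ge0.
have ge_y q : (1 - c * bound) ^+ q * f y <= iter q (M c) f y.
  elim: q => [|q IH]; first by rewrite mul1r.
  rewrite iterS; apply: le_trans (Euler_step_ge_jump c0 cb sr (it0 q) (adjacent_refl y m_gt0)).
  rewrite exprS -mulrA ler_wpDr ?mulr_ge0//.
  by rewrite ler_wpM2l.
elim: N => [|N IH]; first by rewrite !mul0r.
rewrite iterS; apply: le_trans (Euler_step_ge_jump c0 cb sr (it0 N) xy).
have h1 := ler_wpM2l b0 IH.
have cs0 : 0 <= c * s by exact: mulr_ge0.
have h2 := ler_wpM2l cs0 (ge_y N).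
apply: le_trans (lerD h1 h2).
have h3 : 0 <= c * s * ((1 - c * bound) ^+ N * f y) * (c * bound).
  by rewrite !mulr_ge0 ?exprn_ge0// bound_ge0.
rewrite exprS -natr1; nra.
Qed.

(** Cut [N * q] Euler steps into [N] blocks of [q]. A block makes a given adjacent move with weight
    at least [theta], uniformly in [q]; as [N >= m], the blocks lead from [x] to [y], and
    [theta ^+ N] survives the limit in [q]. *)
Lemma zrp_semigroup_gt0 t x y : 0 < t ->
  0 < zrp_semigroup r nu t (fun z => (z == y)%:R) x.
Proof.
move=> t0; have [s s0 sr] := min_rate_gt0.
have [N [mN [N0 NB]]] :
    exists N, (m <= N)%N /\ (0 < N)%N /\ t / N%:R * (bound * 2) <= 1.
  near \oo => N; exists N; split.
    by near: N; exact: nbhs_infty_ge.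
  by near: N; apply: near_small_step; [exact: ltW|rewrite mulr_ge0// bound_ge0].
set e := fun z => (z == y)%:R.
(* In a block [q * (c * s)] equals [t / N * s]; the half bounds [(1 - c * bound) ^ q] from below by
   Bernoulli, thanks to the factor 2 in [NB]. *)
set theta := t / N%:R * s / 2.
have NR : (0 : R) < N%:R by rewrite ltr0n.
have theta0 : 0 < theta by rewrite !mulr_gt0 ?invr_gt0.
have cv : (iter (N * q)%N (M (t / (N * q)%N%:R)) e x @[q --> \oo] -->
    zrp_semigroup r nu t e x).
  apply: (cvg_comp (fun q => N * q)%N
    (fun q => iter q (M (t / q%:R)) e x)); first exact: cvg_mulnl.
  by apply: zrp_semigroup_cvg; exact: ltW.
apply: (@lt_le_trans _ _ (theta ^+ N)); first exact: exprn_gt0.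
apply: (cvgr_to_ge cv); near=> q.
have q0 : (0 < q)%N by near: q; exact: nbhs_infty_gt.
have qR : (0 : R) < q%:R by rewrite ltr0n.
set c := t / _.
have cE : c = t / N%:R / q%:R by rewrite /c natrM; field; rewrite !gt_eqF.
have c0 : 0 <= c by rewrite cE !divr_ge0// ltW.
have qc : q%:R * (c * bound) <= 2^-1.
  have -> : q%:R * (c * bound) = t / N%:R * bound by rewrite cE; field; rewrite !gt_eqF.
  lra.
have q1 : (1 : R) <= q%:R by rewrite ler1n.
have cb0 : 0 <= c * bound by rewrite mulr_ge0// bound_ge0.
have cb : c * bound <= 1 by nra.
have e0 z : 0 <= e z by [].
have step z z' f : (forall z, 0 <= f z) -> adjacent z z' ->
    theta * f z' <= iter q (M c) f z.
  move=> f0 zz; apply: le_trans (iter_Euler_step_ge_jump q c0 cb (ltW s0) sr f0 zz).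
  rewrite ler_wpM2r//.
  have -> : theta = q%:R * (c * s) * 2^-1.
    by rewrite /theta cE; field; rewrite !gt_eqF.
  apply: ler_wpM2l; first by rewrite !mulr_ge0// ltW.
  apply: le_trans (bernoulli q _); last by rewrite cb0.
  lra.
apply: (@adjacent_ind _ _ y
  (fun K z => theta ^+ K <= iter (K * q)%N (M c) e z) m_gt0 _ _ N x mN).
  by rewrite /= /e eqxx.
move=> K z z' zz IH.
rewrite mulSn iterD exprS.
apply: le_trans (step _ _ _ _ zz); first by rewrite ler_wpM2l// ltW.
by move=> u; exact: iter_Euler_step_ge0.
Unshelve. all: by end_near. Qed.

End Semigroup.

(** * The invariant law *)

Section InvariantLaw.
Context {R : realType} {m n : nat}.
Context (nu : 'I_n -> R) (r : 'I_n -> nat -> R).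
Implicit Types (x y : zrp_state m n) (i j : 'I_n).
Context (nu_gt0 : forall i, 0 < nu i).
Context (r_gt0 : forall i q, (1 <= q)%N -> 0 < r i q).

(** The explicit product-form invariant law, without its normalising constant. *)
Definition zrp_weight x : R :=
  \prod_i \prod_(1 <= q < (occ x i).+1) (nu i / r i q).

Lemma zrp_weight_gt0 x : 0 < zrp_weight x.
Proof.
apply: prodr_gt0 => i _; rewrite big_nat; apply: prodr_gt0 => q /andP[q1 _].
by rewrite divr_gt0// r_gt0.
Qed.

(** Multiplying by [r k (occ z k)] cancels the last factor of site [k], leaving [nu k] times the
    weight of the other particles, which the jump does not affect. *)
Lemma zrp_weight_balance x i j : (0 < occ x i)%N ->
  zrp_weight x * (r i (occ x i) * nu j) =
  zrp_weight (jump x i j) * (r j (occ (jump x i j) j) * nu i).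
Proof.
have H (z : zrp_state m n) k : (0 < occ z k)%N ->
    zrp_weight z * r k (occ z k) =
    nu k * \prod_l \prod_(1 <= q < (occ z l - (l == k)).+1) (nu l / r l q).
  move=> zk; rewrite /zrp_weight (bigD1 k)//= [in RHS](bigD1 k)//= eqxx subn1.
  rewrite big_nat_recr//= prednK//.
  under [X in _ = nu k * (_ * X)]eq_bigr => l /negbTE lk do rewrite lk subn0.
  have rk : r k (occ z k) != 0 by rewrite gt_eqF// r_gt0.
  by field.
move=> xi; rewrite !mulrA (H _ _ xi) (H _ _ (occ_jump_gt0 j xi)).
rewrite mulrAC [RHS]mulrAC [nu i * _]mulrC; congr (_ * _).
by apply: eq_bigr => l _; rewrite occ_jump_sub.
Qed.

End InvariantLaw.

Lemma zrp_delta_le {R : realType} {n : nat} m (r : 'I_n -> nat -> R) i q :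
  (1 <= q <= m)%N -> zrp_delta m r <= r i q - r i q.-1.
Proof.
move=> qm; rewrite /zrp_delta; apply: bigmin_inf_seq (lexx _) => //.
by apply/allpairsP; exists (i, q); rewrite mem_enum mem_iota add1n ltnS.
Qed.

Lemma zrp_delta_ge0 {R : realType} {n : nat} m (r : 'I_n -> nat -> R) :
  (forall i q, (1 <= q <= m)%N -> r i q.-1 <= r i q) -> 0 <= zrp_delta m r.
Proof.
move=> r_mono.
have s0 : {in zrp_increments m r, forall d, 0 <= d}.
  move=> d /allpairsP[[i q] /= [_]].
  by rewrite mem_iota add1n ltnS => /r_mono ? ->; rewrite subr_ge0.
have h0 : 0 <= head 0 (zrp_increments m r).
  by case: (zrp_increments m r) s0 => //= d s; apply; rewrite mem_head.
rewrite /zrp_delta big_seq; elim/big_ind: _ => // a b a0 b0.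
by rewrite le_min a0.
Qed.

(** By reversibility [pi / w] is harmonic for [K]; the maximum principle for a positive kernel makes
    it constant. *)
Lemma invariant_proportional {R : realType} {T : finType} (K : T -> T -> R)
    (w pi : T -> R) :
  (forall x, is_law (K x)) -> (forall x y, 0 < K x y) -> (forall x, 0 < w x) ->
  (forall x y, w x * K x y = w y * K y x) -> is_law pi ->
  (forall y, \sum_x pi x * K x y = pi y) ->
  exists2 c, 0 < c & forall x, pi x = c * w x.
Proof.
move=> lK K0 w0 K_rev [pi0 pi1] inv.
have [x0 _] : exists x : T, true.
  apply/existsP; apply: contraT; rewrite negb_exists => /forallP noT.
  by move: pi1; rewrite big1 ?(eq_sym 0) => [/esym/eqP|x]; [rewrite oner_eq0|have := noT x].
set h := fun x => pi x / w x.
have hK y : mean (K y) h = h y.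
  rewrite {2}/h -inv mulr_suml; apply: eq_bigr => x _.
  have wx := w0 x; have wy := w0 y.
  apply: (mulfI (lt0r_neq0 wy)); rewrite mulrA -K_rev /h.
  by field; rewrite !gt_eqF.
case: (@arg_maxP _ _ _ x0 predT h isT) => z _ z_max.
have hz x : h x = h z.
  have /psumr_eq0P : \sum_y K z y * (h z - h y) = 0.
    by rewrite -[LHS]/(mean _ _) meanB hK mean_cst// subrr.
  move=> /(_ _ x isT) /eqP.
  rewrite mulf_eq0 gt_eqF//= subr_eq0 => H; apply/esym/eqP/H => y _.
  by rewrite mulr_ge0 ?(ltW (K0 _ _))// subr_ge0; exact: z_max.
have piE x : pi x = h z * w x by rewrite -(hz x) /h divfK// gt_eqF.
exists (h z) => //.
rewrite lt_neqAle divr_ge0 ?(ltW (w0 z))// andbT eq_sym; apply/eqP => hz0.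
move: pi1; rewrite big1 => [/esym/eqP|x _]; first by rewrite oner_eq0.
by rewrite piE hz0 mul0r.
Qed.

Theorem corollary7 (R : realType) (m n : nat) (hm : (1 <= m)%N) (hn : (1 <= n)%N)
  (nu : 'I_n -> R) (hnu : is_law nu) (hnu_pos : forall i, 0 < nu i)
  (r : 'I_n -> nat -> R)
  (hr0 : forall i, r i 0%N = 0)
  (hr_pos : forall i k, (1 <= k)%N -> 0 < r i k)
  (hr_mono : forall i k, (1 <= k <= m)%N -> r i k.-1 <= r i k)
  (pi : zrp_state m n -> R) (hpi : zrp_invariant r nu pi) :
  forall mu : zrp_state m n -> R, is_law mu ->
  forall t : R, 0 <= t ->
    rel_entropy (zrp_evolve r nu t mu) pi
      <= expR (- zrp_delta m r * t) * rel_entropy mu pi.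
Proof.
(* Time zero is treated apart, as the kernel is positive only for [t > 0]. *)
move=> mu [mu0 mu1] t; rewrite le_eqVlt => /predU1P[<-|t0].
  rewrite mulr0 expR0 mul1r /rel_entropy.
  suff -> : zrp_evolve r nu 0 mu = mu by [].
  apply/funext => y; rewrite /zrp_evolve.
  have P0 x : zrp_semigroup r nu 0 (fun z => (z == y)%:R) x = (x == y)%:R.
    apply: (cvgn_unique (@zrp_semigroup_cvg _ _ _ nu r 0 _ x (lexx 0))).
    have it N : iter N (Euler_step (zrp_gen r nu (m := m)) (0 / N%:R))
        (fun z => (z == y)%:R) x = (x == y)%:R.
      elim: {1}N x => // q IH x; rewrite iterS /Euler_step mul0r mul0r addr0.
      by have := IH x; rewrite /Euler_step mul0r.
    by under eq_fun do rewrite it; exact: cvg_cst.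
  rewrite (bigD1 y)//= P0 eqxx mulr1 big1 ?addr0// => x /negbTE xy.
  by rewrite P0 xy mulr0.
have t_ge0 := ltW t0.
have r_ge0 i q : 0 <= r i q by case: q => [|q]; rewrite ?hr0// ltW// hr_pos.
have d0 := zrp_delta_ge0 hr_mono.
have r_incr i q : (1 <= q <= m)%N -> zrp_delta m r <= r i q - r i q.-1.
  exact: zrp_delta_le.
pose K (x y : zrp_state m n) : R := zrp_semigroup r nu t (fun z => (z == y)%:R) x.
have KE f x : mean (K x) f = zrp_semigroup r nu t f x.
  by rewrite zrp_semigroup_kernel.
have K0 x y : 0 < K x y.
  exact: (zrp_semigroup_gt0 hnu r_ge0 d0 hm hnu_pos hr_pos).
have lK x : is_law (K x).
  split=> [y|]; first exact: ltW.
  by rewrite -(zrp_semigroup_cst nu r 1 x t_ge0) -KE; apply: eq_bigr => y _; rewrite mulr1.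
have indic (p g : zrp_state m n -> R) x :
    mean p (fun z => (z == x)%:R * g z) = p x * g x.
  rewrite /mean (bigD1 x)//= eqxx mul1r big1 ?addr0// => y /negbTE ->.
  by rewrite mul0r mulr0.
have rev (p : zrp_state m n -> R) : (forall x i j, (0 < occ x i)%N ->
    p x * (r i (occ x i) * nu j) =
    p (jump x i j) * (r j (occ (jump x i j) j) * nu i)) ->
    forall x y, p x * K x y = p y * K y x.
  move=> bal x y; rewrite -(indic p (K ^~ y)) -(indic p (K ^~ x)).
  by rewrite (mean_zrp_semigroup hr0 bal)//; apply: eq_mean => z; rewrite mulrC.
(* Invariance at this single time identifies [pi], whence its full support and reversibility. *)
have [c c0 piE] : exists2 c, 0 < c & forall x, pi x = c * zrp_weight nu r x.
  apply: (invariant_proportional lK K0) (proj1 hpi) _.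
  - by move=> x; exact: zrp_weight_gt0.
  - by apply: rev => x i j; exact: zrp_weight_balance.
  - by move=> y; rewrite -[in RHS](proj2 hpi t t_ge0).
have pi0 x : 0 < pi x by rewrite piE mulr_gt0// zrp_weight_gt0.
have pi_rev x y : pi x * K x y = pi y * K y x.
  by apply: rev => {}x i j xi; rewrite !piE -!mulrA zrp_weight_balance.
pose f x := mu x / pi x.
have muE x : mu x = pi x * f x by rewrite /f mulrC divfK// gt_eqF.
have f0 x : 0 <= f x by rewrite divr_ge0// ltW.
have f1 : mean pi f = 1 by rewrite -mu1; apply: eq_bigr => x _; rewrite -muE.
(* By reversibility the density of the evolved law is the kernel applied to the density [f]. *)
have evE y : zrp_evolve r nu t mu y = pi y * mean (K y) f.
  rewrite /mean mulr_sumr; apply: eq_bigr => x _.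
  by rewrite muE mulrA -pi_rev -/(K x y); ring.
have -> : rel_entropy (zrp_evolve r nu t mu) pi = entropy pi (fun x => mean (K x) f).
  apply: eq_bigr => x _; rewrite evE -mulrA; congr (_ * (_ * ln _)).
  by rewrite mulrC mulKf// gt_eqF.
have -> : rel_entropy mu pi = entropy pi f.
  by apply: eq_bigr => x _; rewrite -/(f x) muE -mulrA.
(* Taking [C = 1] gives the Lipschitz contraction, taking [l = 0] the log-Lipschitz bound. *)
have adj C l g : 0 <= l -> (forall x, 0 <= (C - 1) * g x) ->
    (forall x y, adjacent x y -> g x <= C * g y + l) ->
    forall x y, adjacent x y -> mean (K x) g <= C * mean (K y) g +
      expR (- zrp_delta m r * t) * l.
  move=> l0 Cg gl x y xy; rewrite !KE.
  exact: (zrp_semigroup_adjacent hnu hr0 r_ge0 d0 r_incr).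
apply: (entropy_contraction (e := adjacent) (D := m) (proj1 hpi) lK K0 pi_rev) => //.
- move=> g l gl x y.
  apply: (adjacent_ind (y := y) (Q := fun N z => g z <= g y + N%:R * l) hm) => //.
    by rewrite mul0r addr0.
  by move=> N z z' /gl zz' IH; apply: le_trans zz' _; rewrite -natr1; lra.
- move=> g l l0 gl x y xy; rewrite -[mean (K y) g]mul1r; apply: adj => // [z|z z' zz'].
    by rewrite subrr mul0r.
  by rewrite mul1r; exact: gl.
- move=> g C g0 C1 gC x y xy; rewrite -[leRHS]addr0 -(mulr0 (expR (- zrp_delta m r * t))).
  apply: adj => // [z|z z' zz']; first by rewrite mulr_ge0// subr_ge0.
  by rewrite addr0; exact: gC.
Qed.
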